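(* Let $k\ge 3$, $3<n\le k$, and $f\in P_k^n$. Then the following are equivalent: (i) $f\in G_{2,k}^{n,-}$; (ii) $f=t\oplus g$, where $g\in G_{n,k}^n$ with $g_{i\leftarrow j}=0$ for all $1\le i,j\le n$, $i\neq j$, and $t\in P_k^n$ is a totally symmetric function with $Ess(t_{i\leftarrow j})=\{x_1,\ldots,x_n\}\setminus\{x_i,x_j\}$ for all $i,j\in\{1,\ldots,n\}$, $i\neq j$.
   Context: $K=\{0,1,\ldots,k-1\}$ is the ring of residues modulo $k$, $\oplus$ is pointwise addition modulo $k$. $P_k^n$ is the set of all functions $K^n\to K$ in variables $x_1,\ldots,x_n$. A function is totally symmetric if it is invariant under every permutation of its arguments. A variable $x_i$ is essential in $g$ if changing only the $i$-th argument can change the value of $g$; $Ess(g)$ is the set of essential variables, $ess(g)=|Ess(g)|$. For $i\neq j$, $g_{i\leftarrow j}(a_1,\ldots,a_n)=g(a_1,\ldots,a_{i-1},a_j,a_{i+1},\ldots,a_n)$. $Min(g)$ is the set of all $g_{i\leftarrow j}$ with $i\neq j$ and $x_i,x_j\in Ess(g)$; $gap(g)=ess(g)-\max_{s\in Min(g)}ess(s)$. $G_{p,k}^m=\{f\in P_k^n: ess(f)=m,\ gap(f)=p\}$. $G_{p,k}^{n,-}$ is the set of $f\in G_{p,k}^n$ such that $x_v\notin Ess(f_{u\leftarrow v})$ for all $u\neq v$ in $\{1,\ldots,n\}$. *)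

(* Defs.v *)
From mathcomp Require Import all_boot perm ssralg zmodp.

Set Implicit Arguments.
Unset Strict Implicit.
Unset Printing Implicit Defensive.

(* P_k^n. The type 'Z_k has k elements only for 1 < k. Variables are indexed  *)
(* from 0, and the pointwise sum modulo k is the addition of the canonical    *)
(* additive group structure on this type of finite functions.                 *)
Notation kfun k n := {ffun {ffun 'I_n -> 'Z_k} -> 'Z_k}.

Section KFun.
Variables (k n : nat).
Implicit Types (f g t : kfun k n) (i j u v : 'I_n).

Definition totally_symmetric t : Prop :=
  forall (s : {perm 'I_n}) (a : {ffun 'I_n -> 'Z_k}),
    t [ffun i => a (s i)] = t a.

Definition Ess g : {set 'I_n} :=
  [set i | [exists a : {ffun 'I_n -> 'Z_k}, exists b : {ffun 'I_n -> 'Z_k},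
              [forall j, (j != i) ==> (a j == b j)] && (g a != g b)]].

Definition ess g : nat := #|Ess g|.

(* g_{i <- j} *)
Definition minor g i j : kfun k n :=
  [ffun a : {ffun 'I_n -> 'Z_k} => g [ffun l => if l == i then a j else a l]].

Definition Min g : {set kfun k n} :=
  [set minor g i j | i in Ess g, j in Ess g & i != j].

(* The subtraction never truncates, as Ess (minor g i j) \subset Ess g for    *)
(* i, j in Ess g. The maximum over an empty Min g (ess g < 2) is 0.           *)
Definition gap g : nat := ess g - \max_(s in Min g) ess s.

(* G_{p,k}^m as a subset of P_k^n *)
Definition G (p m : nat) : {set kfun k n} :=
  [set f : kfun k n | (ess f == m) && (gap f == p)].

(* G_{p,k}^{n,-} *)
Definition Gminus (p : nat) : {set kfun k n} :=
  [set f in G p n | [forall u, forall v,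
                       (u != v) ==> (v \notin Ess (minor f u v))]].

End KFun.

Arguments G : clear implicits.
Arguments Gminus : clear implicits.

(* Main.v *)
Require Import Defs.
From mathcomp Require Import all_boot perm ssralg zmodp.

(** If [x_v] is never essential in [f_{u <- v}], then [f] does not depend on the
    common value of two equal arguments.  Such a pair acts as a blank: the value
    of any third argument can be moved into it by
    [f(c,c,b,..) = f(b,b,b,..) = f(b,c,c,..)], and three such moves realise every
    transposition.  Hence [f] is symmetric on the tuples with a repetition, and
    [t] is obtained from [f] by replacing its values on injective tuples by a
    suitable constant.  What is left, [g = f - t], is supported on injective
    tuples, and these exist because [n <= k]. *)

Section Minors.
Set Implicit Arguments.
Unset Strict Implicit.
Variables (k n : nat).
Implicit Types (f g t : kfun k n) (i j l u v w : 'I_n).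
Implicit Types (a b : {ffun 'I_n -> 'Z_k}) (s : {perm 'I_n}).

Lemma EssP g i :
  reflect (exists a b, (forall j, j != i -> a j = b j) /\ g a <> g b)
          (i \in Ess g).
Proof.
rewrite inE; apply: (iffP existsP) => [[a /existsP[b /andP[/forallP ab gab]]]|].
  exists a, b; split; last by apply/eqP.
  by move=> j ji; have /implyP/(_ ji)/eqP := ab j.
move=> [a [b [ab /eqP gab]]]; exists a; apply/existsP; exists b.
by rewrite gab andbT; apply/forallP => j; apply/implyP => /ab ->.
Qed.

Lemma notin_Ess g i a b :
  i \notin Ess g -> (forall j, j != i -> a j = b j) -> g a = g b.
Proof.
move=> iNg ab; apply/eqP; apply: contraNT iNg => /eqP gab.
by apply/EssP; exists a, b.
Qed.

Lemma Ess0 : Ess (0%R : kfun k n) = set0.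
Proof.
by apply/setP => i; rewrite in_set0; apply/EssP => -[a [b [_ []]]]; rewrite !ffunE.
Qed.

Lemma noninjectiveP a :
  reflect (exists u v, u != v /\ a u = a v) (~~ injectiveb a).
Proof.
apply: (iffP (injectivePn a)) => [[u [v uv auv]]|[u [v [uv auv]]]].
  by exists u, v.
by exists u, v.
Qed.

Lemma minorD f g i j : minor (f + g)%R i j = (minor f i j + minor g i j)%R.
Proof. by apply/ffunP => a; rewrite !ffunE. Qed.

Lemma minor_id g i j a : a i = a j -> minor g i j a = g a.
Proof.
move=> aij; rewrite ffunE; congr (g _); apply/ffunP => l; rewrite ffunE.
by case: eqP => // ->.
Qed.

(** A minor evaluates its function only at tuples with a repetition, so values on injective tuples
    can be altered without changing any minor. *)
Lemma eq_minor f g i j :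
  i != j -> (forall a, ~~ injectiveb a -> f a = g a) -> minor f i j = minor g i j.
Proof.
move=> ij fg; apply/ffunP => a; rewrite !ffunE; apply: fg.
apply/noninjectiveP; exists i, j; split=> //.
by rewrite !ffunE eqxx eq_sym (negPf ij).
Qed.

Lemma minor_eq0 g i j a : minor g i j = 0%R -> a i = a j -> g a = 0%R.
Proof. by move=> g0 /(minor_id g) <-; rewrite g0 ffunE. Qed.

Lemma Ess_minor_l g i j : i != j -> i \notin Ess (minor g i j).
Proof.
move=> ij; apply/EssP => -[a [b [ab]]]; apply; rewrite !ffunE; congr (g _).
apply/ffunP => l; rewrite !ffunE; case: eqP => [_|/eqP li]; last exact: ab.
by apply: ab; rewrite eq_sym.
Qed.

Lemma Ess_minorS g i j l :
  l != i -> l != j -> l \in Ess (minor g i j) -> l \in Ess g.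
Proof.
move=> li lj /EssP[a [b [ab]]]; rewrite !ffunE => gab; apply/EssP.
exists [ffun m => if m == i then a j else a m].
exists [ffun m => if m == i then b j else b m]; split=> // m ml.
by rewrite !ffunE !ab // eq_sym.
Qed.

(** Renaming positions by [s] turns the minor at [i], [j] into the one at [s i], [s j]. This lets a
    single minor determine the essential variables of all the others. *)
Lemma Ess_minor_perm t s i j l : totally_symmetric t ->
  l \in Ess (minor t i j) -> s l \in Ess (minor t (s i) (s j)).
Proof.
move=> tS /EssP[a [b [ab tab]]].
have move_s (c : {ffun 'I_n -> 'Z_k}) :
    minor t (s i) (s j) [ffun m => c (s^-1%g m)] = minor t i j c.
  rewrite !ffunE -[LHS](tS s); congr (t _); apply/ffunP => m.
  by rewrite !ffunE (inj_eq perm_inj) !permK.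
apply/EssP; exists [ffun m => a (s^-1%g m)], [ffun m => b (s^-1%g m)].
rewrite !move_s; split=> // m ml; rewrite !ffunE; apply: ab.
by apply: contraNneq ml => <-; rewrite permKV.
Qed.

Lemma perm_pair u v i j : u != v -> i != j -> exists s, s u = i /\ s v = j.
Proof.
move=> uv ij; exists (tperm u i * tperm (tperm u i v) j)%g.
rewrite !permM tpermL tpermL; split=> //; apply: tpermD; last by rewrite eq_sym.
by rewrite -{2}[i](tpermL u i) (inj_eq perm_inj) eq_sym.
Qed.

Lemma mem_Min g i j :
  i \in Ess g -> j \in Ess g -> i != j -> minor g i j \in Min g.
Proof. by move=> iE jE ij; apply: imset2_f; rewrite // inE jE. Qed.

Lemma card_setTD2 i j : i != j -> #|[set: 'I_n] :\: [set i; j]| = n - 2.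
Proof.
by move=> ij; rewrite cardsD setTI cardsT card_ord cards2 ij.
Qed.

Section Blanks.
Variable f : kfun k n.
Hypothesis fN : forall u v, u != v -> v \notin Ess (minor f u v).

(** The two positions are changed one at a time in [minor f u v], which ignores [u] by construction
    and [v] by [fN]. *)
Lemma eq_off_blank u v a b : u != v -> a u = a v -> b u = b v ->
  (forall l, l != u -> l != v -> a l = b l) -> f a = f b.
Proof.
move=> uv auv buv ab; rewrite -(minor_id f auv) -(minor_id f buv).
transitivity (minor f u v [ffun l => if l == u then b u else a l]).
  apply: notin_Ess (Ess_minor_l f uv) _ => l lu.
  by rewrite ffunE (negPf lu).
apply: notin_Ess (fN uv) _ => l lv; rewrite ffunE.
by case: eqP => [->//|/eqP lu]; apply: ab.
Qed.

Lemma blank_tperm u v w a : u != v -> w != v -> a u = a v ->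
  f [ffun l => a (tperm u w l)] = f a.
Proof.
move=> uv wv auv; have [<-|uw] := eqVneq u w.
  by congr (f _); apply/ffunP => l; rewrite ffunE tperm1 perm1.
(* At this tuple [u], [v] and [w] all hold [a w], so both [v, w] and [u, v] are blanks there. *)
transitivity (f [ffun l => if (l == u) || (l == v) then a w else a l]).
  apply: (@eq_off_blank v w); rewrite 1?eq_sym // ?ffunE.
  - by rewrite tpermR tpermD // eq_sym.
  - by rewrite !eqxx orbT eq_sym (negPf uw) (negPf wv).
  move=> l lv lw; rewrite !ffunE (negPf lv) orbF.
  by case: (eqVneq l u) => [->|lu]; rewrite ?tpermL // tpermD // eq_sym.
apply: (@eq_off_blank u v) => //.
  by rewrite !ffunE !eqxx orbT.
by move=> l lu lv; rewrite ffunE (negPf lu) (negPf lv).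
Qed.

Lemma noninjective_tperm w z a : ~~ injectiveb a ->
  f [ffun l => a (tperm w z l)] = f a.
Proof.
case/noninjectiveP=> u [v [uv auv]].
(* The two positions of the blank play the same role, and [w] equals at most one of them. *)
wlog wv : u v uv auv / w != v => [hw|].
  have [wv|wv] := eqVneq w v; last exact: (hw u v).
  by apply: (hw v u); rewrite ?wv 1?eq_sym.
have [->|zv] := eqVneq z v.
  have [wu|wu] := eqVneq w u.
    congr (f _); apply/ffunP => l; rewrite ffunE wu.
    by case: tpermP => // ->; rewrite auv.
  by rewrite tpermC; apply: (@blank_tperm v u w); rewrite // eq_sym.
have [->|wu] := eqVneq w u; first exact: (@blank_tperm u v).
have [->|zu] := eqVneq z u; first by rewrite tpermC; apply: (@blank_tperm u v).
have [->|wz] := eqVneq w z.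
  by congr (f _); apply/ffunP => l; rewrite ffunE tperm1 perm1.
have dv x y : x != v -> y != v -> tperm x y v = v by move=> *; apply: tpermD.
(* One end of the blank stays at [v]; the other travels from [u] to [w], then to [z], then back to
   [u]. The three swaps compose to [tperm w z]. *)
pose a1 := [ffun l => a (tperm u w l)].
pose a2 := [ffun l => a1 (tperm w z l)].
transitivity (f [ffun l => a2 (tperm z u l)]).
  congr (f _); apply/ffunP => l; rewrite !ffunE; congr (a _).
  case: (tpermP z u l) => [->|->|/eqP lz /eqP lu].
  - by rewrite tpermR [tperm w z u]tpermD 1?tpermL.
  - by rewrite !tpermR tpermD // eq_sym.
  have [->|lw] := eqVneq l w; first by rewrite tpermL tpermD // eq_sym.
  by rewrite !tpermD // eq_sym.
rewrite (@blank_tperm z v u) ?ffunE ?tpermR ?dv ?tpermR //.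
rewrite (@blank_tperm w v z) ?ffunE ?tpermR ?dv //.
exact: (@blank_tperm u v w).
Qed.

(** Permuting positions preserves repetitions, so the case of a transposition applies to each factor
    of a decomposition of [s]. *)
Lemma noninjective_perm s a : ~~ injectiveb a ->
  f [ffun l => a (s l)] = f a.
Proof.
have [ts -> _] := prod_tpermP s; elim: ts a => [|[w z] ts IHts] a aN.
  by congr (f _); apply/ffunP => l; rewrite ffunE big_nil perm1.
rewrite big_cons /= -[RHS]IHts //.
rewrite -(@noninjective_tperm w z [ffun l => a ((\prod_(t <- ts) tperm t.1 t.2)%g l)]).
  by congr (f _); apply/ffunP => l; rewrite !ffunE permM.
apply: contra aN => /injectiveP aI; apply/injectiveP => x y axy.
set p := (\prod_(t <- ts) _)%g in aI.
have := aI (p^-1 x)%g (p^-1 y)%g; rewrite !ffunE !permKV => /(_ axy).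
exact: perm_inj.
Qed.

End Blanks.

End Minors.

Theorem theorem4p9 (k n : nat) (hk : 3 <= k) (hn : 3 < n <= k) (f : kfun k n) :
  f \in Gminus k n 2 <->
  exists t g : kfun k n,
    [/\ f = (t + g)%R,
        g \in G k n n n,
        (forall i j : 'I_n, i != j -> minor g i j = 0%R),
        totally_symmetric t &
        (forall i j : 'I_n, i != j ->
           Ess (minor t i j) = [set: 'I_n] :\: [set i; j])].
Proof.
have /andP[n_gt3 n_le_k] := hn.
have n_gt1 : 1 < n by exact: leq_trans n_gt3.
split=> [|[t [g [-> _ g0 _ tE]]]]; last first.
  have fE i j : i != j ->
      Ess (minor (t + g)%R i j) = [set: 'I_n] :\: [set i; j].
    by move=> ij; rewrite minorD g0 // GRing.addr0 tE.
  have fT : Ess (t + g)%R = [set: 'I_n].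
    apply/setP => l; rewrite in_setT.
    (* A variable [l] is essential in any minor at two other positions, hence in the sum itself. *)
    have: 1 < #|[set~ l]| by rewrite cardsC1 card_ord -subn1 ltn_subRL ltnW.
    case/card_gt1P=> i [j []]; rewrite !in_setC1 => il jl ij.
    apply: (@Ess_minorS _ _ _ i j); rewrite 1?eq_sym //.
    by rewrite fE // !inE negb_or andbT eq_sym il eq_sym jl.
  have essT : ess (t + g)%R = n by rewrite /ess fT cardsT card_ord.
  have maxE : \max_(s in Min (t + g)%R) ess s = n - 2.
    apply/eqP; rewrite eqn_leq; apply/andP; split.
      apply/bigmax_leqP => s /imset2P[i j _].
      by rewrite inE => /andP[_ ij] ->; rewrite /ess fE // card_setTD2.
    have ij : Ordinal (ltnW n_gt1) != Ordinal n_gt1 by [].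
    rewrite -(card_setTD2 ij) -fE //.
    apply: (@leq_bigmax_cond _ _ (@ess k n)).
    by apply: mem_Min; rewrite ?fT ?inE.
  rewrite inE; apply/andP; split.
    by rewrite inE essT eqxx /gap essT maxE subKn.
  by apply/forallP => u; apply/forallP => v; apply/implyP => uv; rewrite fE // !inE eqxx orbT.
rewrite inE => /andP[]; rewrite inE => /andP[/eqP essf /eqP gapf] /forallP fN'.
have fN u v : u != v -> v \notin Ess (minor f u v).
  by move=> uv; have /forallP/(_ v)/implyP/(_ uv) := fN' u.
(* The carrier of ['Z_k] is ['I_(Zp_trunc k).+2], whose size is [k] because [1 < k]. *)
have k_cast : n <= (Zp_trunc k).+2 by rewrite Zp_cast // (leq_trans _ hk).
pose a0 : {ffun 'I_n -> 'Z_k} := [ffun i => widen_ord k_cast i].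
have a0I : injectiveb a0.
  by apply/injectiveP => i j; rewrite !ffunE => -[] /val_inj.
(* Any constant on injective tuples keeps [t] symmetric; [f a0 + 1] makes [f - t] equal to [-1],
   hence nonzero, at [a0]. *)
pose t : kfun k n :=
  [ffun a : {ffun 'I_n -> 'Z_k} => if injectiveb a then f a0 + 1 else f a]%R.
have tf (a : {ffun 'I_n -> 'Z_k}) : ~~ injectiveb a -> t a = f a.
  by move=> aN; rewrite ffunE (negPf aN).
have minor_t i j : i != j -> minor t i j = minor f i j.
  by move=> ij; apply: eq_minor.
have tS : totally_symmetric t.
  move=> s a; rewrite !ffunE.
  have ->: injectiveb [ffun i => a (s i)] = injectiveb a.
    apply/injectiveP/injectiveP => aI x y.
      have := aI (s^-1 x)%g (s^-1 y)%g; rewrite !ffunE !permKV => h /h.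
      exact: perm_inj.
    by rewrite !ffunE => /aI/perm_inj.
  by case: ifPn => // aN; apply: noninjective_perm.
exists t, (f - t)%R.
have g0 i j : i != j -> minor (f - t)%R i j = 0%R.
  move=> ij; apply: (GRing.addrI (minor t i j)).
  by rewrite -minorD GRing.addrC GRing.subrK GRing.addr0 minor_t.
have gE : Ess (f - t)%R = [set: 'I_n].
  apply/setP => i; rewrite in_setT.
  have: 0 < #|[set~ i]| by rewrite cardsC1 card_ord -subn1 ltn_subRL.
  case/card_gt0P=> j; rewrite in_setC1 => ji; apply/EssP.
  (* Copying entry [j] into position [i] creates a repetition, so [f - t] passes from [-1] to
     [0]. *)
  exists a0, [ffun l => if l == i then a0 j else a0 l]; split.
    by move=> l li; rewrite [RHS]ffunE (negPf li).
  rewrite [X in _ <> X](@minor_eq0 _ _ _ i j) ?g0 1?eq_sym //; last first.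
    by rewrite !ffunE eqxx (negPf ji).
  rewrite !ffunE a0I GRing.opprD GRing.addrA GRing.subrr GRing.sub0r.
  by apply/eqP; rewrite GRing.oppr_eq0 GRing.oner_neq0.
have fT : Ess f = [set: 'I_n].
  by apply/eqP; rewrite eqEcard [#|Ess f|]essf subsetT cardsT card_ord leqnn.
have fES i j : i != j -> Ess (minor f i j) \subset [set: 'I_n] :\: [set i; j].
  move=> ij; apply/subsetP => l lE; rewrite !inE andbT negb_or.
  by apply/andP; split; apply: contraTneq lE => ->; [apply: Ess_minor_l|apply: fN].
(* As [Min f] is nonempty, its maximum is attained. Gap 2 makes it at least [n - 2], so the
   inclusion [fES] is an equality there. *)
have [u [v [uv uvE]]] : exists u v,
    u != v /\ Ess (minor f u v) = [set: 'I_n] :\: [set u; v].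
  have Min_gt0 : 0 < #|Min f|.
    apply/card_gt0P; exists (minor f (Ordinal (ltnW n_gt1)) (Ordinal n_gt1)).
    by apply: mem_Min; rewrite ?fT ?inE.
  have [s /imset2P[u v _]] := eq_bigmax_cond (@ess k n) Min_gt0.
  rewrite inE => /andP[_ uv] -> maxE; exists u, v; split=> //.
  apply/eqP; rewrite eqEcard fES //= card_setTD2 // -[#|Ess _|]maxE.
  by move: gapf; rewrite /gap essf => <-; rewrite leq_subCl.
split=> //.
- by rewrite GRing.addrC GRing.subrK.
- rewrite inE /gap /ess gE cardsT card_ord eqxx.
  rewrite big1 ?subn0 ?eqxx // => s /imset2P[i j _].
  by rewrite inE => /andP[_ ij] ->; rewrite g0 // Ess0 cards0.
move=> i j ij; apply/eqP; rewrite eqEsubset {1}minor_t // fES //=.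
apply/subsetP => l; rewrite in_setD in_setT in_set2 andbT negb_or => /andP[li lj].
(* Symmetry of [t] transports this equality from the pair [u, v] to the pair [i, j]. *)
have [s [si sj]] := perm_pair uv ij.
rewrite -si -sj -(permKV s l); apply: Ess_minor_perm => //.
have sE x : (s^-1%g l == x) = (l == s x).
  by rewrite -[LHS](inj_eq (@perm_inj _ s)) permKV.
by rewrite minor_t // uvE in_setD in_setT in_set2 !sE si sj negb_or li lj.
Qed.
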